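(* Let $k$ be a field of characteristic $p>0$, $\phi=T_1+\cdots+T_s$, and let $D=D_{\phi,p}(t_1,\ldots,t_s,r)$ be the kernel function of $\phi$ over $k$. Let $n_1,\ldots,n_s\ge1$ be integers, $R=k[x_1,\ldots,x_s]$, $I=(x_1,\ldots,x_s)$ and $f=\sum_{1 \leq i \leq s}x_i^{n_i}$. Then for all $r\in\mathbb R$ $$h_{R,I,f}(r)=n_1\cdots n_s\,D(1/n_1,\ldots,1/n_s,r).$$
   Context: With $q=p^e$ and $I^{[q]}$ the ideal generated by $q$-th powers of elements of $I$: for a Noetherian ring $R$ of characteristic $p$, an ideal $I$ and a sequence $\underline f=(f_1,\ldots,f_s)$ with $(I,\underline f)$ primary to a maximal ideal $\mathfrak m$, $h_{R,I,\underline f}(\mathbf t)=\lim_{q\to\infty}l(R/(I^{[q]},f_1^{\lceil qt_1\rceil},\ldots,f_s^{\lceil qt_s\rceil}))/q^{\dim R_{\mathfrak m}}$ (nonpositive powers generate the unit ideal). The kernel function is $D_{\phi}(\mathbf t,r)=h_{k[T_1,\ldots,T_s],0,(T_1,\ldots,T_s,\phi)}(\mathbf t,r)=\lim_{q\to\infty}q^{-s}\,l\big(k[T_1,\ldots,T_s]/(T_1^{\lceil t_1q\rceil},\ldots,T_s^{\lceil t_sq\rceil},\phi^{\lceil rq\rceil})\big)$. *)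

(* Defs.v *)
From HB Require Import structures.
From mathcomp Require Import all_boot all_order all_algebra.
From mathcomp Require Import boolp classical_sets reals ereal topology.
From mathcomp Require Import normedtype sequences.
(* The notations of [mpoly] clash with those of MathComp-Analysis. *)
From mathcomp Require mpoly.
Import -(notations) mpoly.
Import Order.TTheory GRing.Theory Num.Theory.

Set Implicit Arguments.
Unset Strict Implicit.
Unset Printing Implicit Defensive.

Local Open Scope classical_set_scope.
Local Open Scope ring_scope.

Section CommutativeAlgebra.
Variable A : comNzRingType.
Implicit Types (I J M P : set A) (S : set (set A)).

(* The unit ideal is allowed, unlike in [idealr_closed] of ring_quotient. *)
Definition is_ideal I : Prop :=
  [/\ I 0, (forall x y, I x -> I y -> I (x + y)) &
      (forall a x, I x -> I (a * x))].

Definition is_prime P : Prop :=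
  [/\ is_ideal P, ~ P 1 & (forall x y, P (x * y) -> P x \/ P y)].

Definition ideal_gen (X : set A) : set A := smallest is_ideal X.

Definition radical I : set A := [set x | exists m : nat, I (x ^+ m)].

Definition frobenius_power I (q : nat) : set A :=
  ideal_gen [set x ^+ q | x in I].

(* C 0 < C 1 < ... < C n, a chain of length n (with n + 1 members) in S *)
Definition has_chain S (n : nat) : Prop :=
  exists C : nat -> set A,
    (forall i, (i <= n)%N -> S (C i)) /\
    (forall i, (i < n)%N -> C i `<` C i.+1).

(* The length of the A-module A/J: its submodules are the L/J, for L an ideal
   containing J. It is +oo when A/J does not have finite length. *)
Definition colength (R : realType) J : \bar R :=
  ereal_sup [set (n%:R)%:E |
    n in has_chain [set L | is_ideal L /\ J `<=` L]].

(* The Krull dimension of the localization A_M at a prime ideal M: the primes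
   of A_M correspond to the primes of A contained in M. This supremum is a
   maximum when A is Noetherian; the value 0 is used when there is none. *)
Definition local_dim M : nat :=
  xget 0%N [set d | has_chain [set P | is_prime P /\ P `<=` M] d /\
    forall n, has_chain [set P | is_prime P /\ P `<=` M] n -> (n <= d)%N].

End CommutativeAlgebra.

(* max(ceil(x), 0): a nonpositive power of f generates the unit ideal, as does
   f ^+ 0 = 1. *)
Definition ceil_nat (R : realType) (x : R) : nat :=
  if Num.ceil x is Posz n then n else 0%N.

Section HFunction.
Variables (R : realType) (A : comNzRingType) (p s : nat).
Variables (I : set A) (f : s.-tuple A).

Definition h_ideal (t : s.-tuple R) (q : nat) : set A :=
  ideal_gen (frobenius_power I q `|`
    [set tnth f i ^+ ceil_nat (q%:R * tnth t i) | i in [set: 'I_s]]).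

(* When (I, f) is primary to a maximal ideal, that maximal ideal is the radical
   of (I, f). *)
Definition h_dim : nat :=
  local_dim (radical (ideal_gen (I `|` [set tnth f i | i in [set: 'I_s]]))).

(* The term of index e is the one for q = p ^ e. *)
Definition h_seq (t : s.-tuple R) (e : nat) : \bar R :=
  (colength R (h_ideal t (p ^ e)) * (((p ^ e)%:R ^+ h_dim)^-1)%:E)%E.

Definition h (t : s.-tuple R) : R := fine (lim (h_seq t @ \oo)).

(* The limit defining [h] exists and is finite. *)
Definition h_converges (t : s.-tuple R) : Prop :=
  h_seq t @ \oo --> (h t)%:E.

End HFunction.

Arguments h_seq {R A} p {s} I f t e.
Arguments h {R A} p {s} I f t.
Arguments h_converges {R A} p {s} I f t.

(* [mpoly s k] is the polynomial ring in s variables over k. *)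
Definition mvar (k : fieldType) (s : nat) (i : 'I_s) : mpoly s k :=
  mpolyX k (mnm1 i).

Arguments mvar k {s} i.

Section KernelFunction.
Variables (R : realType) (k : fieldType) (p s : nat) (phi : mpoly s k).

Definition kernel_gens : (s.+1).-tuple (mpoly s k) :=
  [tuple of rcons [tuple mvar k i | i < s] phi].

Definition kernel_fun (t : s.-tuple R) (r : R) : R :=
  h p [set 0] kernel_gens [tuple of rcons t r].

Definition kernel_converges (t : s.-tuple R) (r : R) : Prop :=
  h_converges p [set 0] kernel_gens [tuple of rcons t r].

End KernelFunction.

Arguments kernel_fun {R k} p {s} phi t r.
Arguments kernel_converges {R k} p {s} phi t r.

(* Main.v *)
(* The polynomial ring k[x_1, ..., x_s] is free over k[x_1^n_1, ..., x_s^n_s] on the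
   monomials x^a with a_i < n_i, and f is phi evaluated at the x_i^n_i. Along this
   basis the ideal (x_1^q, ..., x_s^q, f^m) splits as the direct sum, over a, of the
   ideals (T_1^c_1, ..., T_s^c_s, phi^m) with c_i = ceil((q - a_i) / n_i). These
   exponents differ by a bounded amount from ceil(q / n_i), so each of the
   n_1 ... n_s summands has the same length as the quotient defining D up to o(q^s).
   The splitting with all n_i = p shows that multiplying all exponents by p
   multiplies the length by p^s, so that the normalized lengths defining D decrease
   with q and converge. Lengths are computed as k-dimensions, since the quotients
   are Artinian local with residue field k. *)
Require Import Defs.
From HB Require Import structures.
From mathcomp Require Import all_boot all_order all_algebra.
From mathcomp Require Import boolp classical_sets reals ereal topology.
From mathcomp Require Import normedtype sequences.
From mathcomp Require mpoly.
Import -(notations) mpoly.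
Import Order.TTheory GRing.Theory Num.Theory.

Local Open Scope classical_set_scope.
Local Open Scope ring_scope.

Set Implicit Arguments.
Unset Strict Implicit.
Unset Printing Implicit Defensive.

(** * Codimension *)

Section Codimension.
Context {k : fieldType} {V : lmodType k}.
Implicit Types (W : set V) (d : nat).

Definition is_subspace W := W 0 /\ forall a u v, W u -> W v -> W (a *: u + v).

(** The functionals [F] together induce an isomorphism from V/W onto k^d. This expresses dim V/W = d
    without forming the quotient, for [V] possibly of infinite dimension. *)
Definition codim W d := exists F : 'I_d -> V -> k,
  [/\ forall i, scalar (F i),
      forall v, W v <-> forall i, F i v = 0 &
      forall y : 'I_d -> k, exists v, forall i, F i v = y i].

Lemma scalar0 (f : V -> k) : scalar f -> f 0 = 0.
Proof. by move=> lf; have := lf (-1) 0 0; rewrite scaler0 addr0 mulN1r addNr. Qed.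

Lemma scalarB (f : V -> k) u v : scalar f -> f (u - v) = f u - f v.
Proof. by move=> lf; rewrite addrC -scaleN1r lf mulN1r addrC. Qed.

Lemma scalar_lincomb (T : finType) (f : V -> k) (c : T -> k) (u : T -> V) :
  scalar f -> f (\sum_t c t *: u t) = \sum_t c t * f (u t).
Proof.
move=> lf; apply: (big_rec2 (fun x y => f x = y)); first exact: scalar0.
by move=> t x y _ <-; rewrite lf.
Qed.

Lemma subspace_sum W (T : Type) (r : seq T) (P : pred T) (F : T -> V) :
  is_subspace W -> (forall t, P t -> W (F t)) -> W (\sum_(t <- r | P t) F t).
Proof.
move=> [W0 Wlin] WF; apply: (big_ind W) => // x y Wx Wy.
by rewrite -[x]scale1r; exact: Wlin.
Qed.

Lemma codim_fintype W (T : finType) (F : T -> V -> k) :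
  (forall t, scalar (F t)) -> (forall v, W v <-> forall t, F t v = 0) ->
  (forall y : T -> k, exists v, forall t, F t v = y t) -> codim W #|T|.
Proof.
move=> linF kerF surjF; exists (fun i => F (enum_val i)); split=> [i|v|y].
- exact: linF.
- rewrite kerF; split=> [Fv i //|Fv t].
  by rewrite -[t]enum_rankK.
- have [v Fv] := surjF (fun t => y (enum_rank t)).
  by exists v => i; rewrite Fv enum_valK.
Qed.

Lemma codim_subspace W d : codim W d -> is_subspace W.
Proof.
move=> [F [linF kerF _]]; split; first by apply/kerF => i; exact: scalar0.
move=> a u v /kerF Fu /kerF Fv; apply/kerF => i.
by rewrite linF Fu Fv mulr0 addr0.
Qed.

Lemma left_kernel_neq0 m n (A : 'M[k]_(m, n)) :
  (n < m)%N -> exists2 v : 'rV_m, v != 0 & v *m A = 0.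
Proof.
move=> lt_nm; have : kermx A != 0.
  rewrite -mxrank_eq0 mxrank_ker subn_eq0 -ltnNge.
  exact: leq_ltn_trans (rank_leq_col A) lt_nm.
by case/rowV0Pn => v /sub_kermxP vA0 v0; exists v.
Qed.

(** With more than [d] vectors, the matrix of the values [F j (u t)] has a nonzero left kernel,
    which is a nontrivial relation modulo [W]. *)
Lemma codim_indep W d (T : finType) (u : T -> V) : codim W d ->
  (forall c : T -> k, W (\sum_t c t *: u t) -> forall t, c t = 0) ->
  (#|T| <= d)%N.
Proof.
move=> [F [linF kerF _]] indep; rewrite leqNgt; apply/negP.
case/(left_kernel_neq0 (\matrix_(i, j) F j (u (enum_val i)))) => v v0 vM.
case/eqP: v0; apply/rowP => i; rewrite mxE.
rewrite -[i]enum_valK; apply: (indep (fun t => v 0 (enum_rank t))).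
apply/kerF => j; rewrite scalar_lincomb //.
have /rowP/(_ j) := vM; rewrite !mxE => vMj; rewrite -[RHS]vMj.
rewrite (reindex _ (onW_bij _ (enum_val_bij T))) /=.
by apply: eq_bigr => l _; rewrite mxE enum_valK.
Qed.

(** Dually, with fewer than [d] vectors some nontrivial combination of the [F i] kills every [u t],
    hence all of [V], against joint surjectivity. *)
Lemma codim_span W d (T : finType) (u : T -> V) : codim W d ->
  (forall v, exists c : T -> k, W (v - \sum_t c t *: u t)) -> (d <= #|T|)%N.
Proof.
move=> [F [linF kerF surjF]] span; rewrite leqNgt; apply/negP.
case/(left_kernel_neq0 (\matrix_(i, j) F i (u (enum_val j)))) => y y0 yM.
have yF v : \sum_i y 0 i * F i v = 0.
  have [c /kerF Fv] := span v.
  have {}Fv i : F i v = \sum_t c t * F i (u t).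
    rewrite -scalar_lincomb //; apply/eqP; rewrite -subr_eq0; apply/eqP.
    by rewrite -[RHS](Fv i) scalarB.
  under eq_bigr do rewrite Fv mulr_sumr.
  rewrite exchange_big big1 //= => t _.
  have /rowP/(_ (enum_rank t)) := yM; rewrite !mxE => yt.
  rewrite -[RHS](mulr0 (c t)) -[X in _ = c t * X]yt mulr_sumr.
  by apply: eq_bigr => i _; rewrite mxE enum_rankK mulrCA.
case/eqP: y0; apply/rowP => j; rewrite mxE.
have [v Fv] := surjF (fun i => (i == j)%:R).
rewrite -[RHS](yF v) (bigD1 j) //= Fv eqxx mulr1 big1 ?addr0 // => i /negPf ij.
by rewrite Fv ij mulr0.
Qed.

Definition add_line W (w : V) : set V := [set v | exists c, W (v - c *: w)].

(** Some [F j] is nonzero at [w]. Dropping it and correcting the other functionals by multiples of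
    it makes them vanish at [w]. *)
Lemma codim_add_line W d w : codim W d -> ~ W w ->
  (0 < d)%N /\ codim (add_line W w) d.-1.
Proof.
move=> [F [linF kerF surjF]] /kerF/existsNP[j /eqP Fjw]; case: d F linF kerF surjF j Fjw.
  by move=> ? ? ? ? [].
move=> d F linF kerF surjF j Fjw; split=> //=.
exists (fun i v => F (lift j i) v - F (lift j i) w / F j w * F j v).
split=> [i a u v|v|y].
- rewrite !linF mulrDr opprD mulrBr !addrA; congr (_ + _).
  by rewrite -!addrA; congr (_ + _); rewrite addrC mulrCA.
- have FB u c i : F i (u - c *: w) = F i u - c * F i w.
    by rewrite scalarB // -[c *: w]addr0 linF scalar0 ?addr0.
  split=> [[c /kerF Fvc] i|Fv].
    have FE l : F l v = c * F l w by apply/eqP; rewrite -subr_eq0 -FB Fvc.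
    by rewrite !FE mulrCA divfK // subrr.
  exists (F j v / F j w); apply/kerF => l; rewrite FB.
  case: (unliftP j l) => [i ->|->]; last by rewrite divfK // subrr.
  by rewrite -[RHS](Fv i) mulrAC [in RHS]mulrAC [F _ w * _]mulrC.
- have [v Fv] := surjF (fun l => if unlift j l is Some i then y i else 0).
  by exists v => i; rewrite !Fv liftK unlift_none mulr0 subr0.
Qed.

(** Vectors of [W'] are adjoined to [W] one at a time; each lowers the codimension by one, so the
    process stops. *)
Lemma codim_superset W W' d : codim W d -> W `<=` W' -> is_subspace W' ->
  exists d', codim W' d'.
Proof.
elim: d W => [|d IHd] W cW sWW' lW'.
all: have [WW'|/existsNP[w /not_implyP[W'w nWw]]] := pselect (W' `<=` W).
- by exists 0%N; rewrite -(_ : W = W') //; apply/seteqP.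
- by have [] := codim_add_line cW nWw.
- by exists d.+1; rewrite -(_ : W = W') //; apply/seteqP.
- have [_ /IHd/=] := codim_add_line cW nWw; apply => //.
  move=> v [c /sWW' W'v]; rewrite -[v](subrK (c *: w)) addrC.
  exact: (proj2 lW').
Qed.

(** Vectors dual to the functionals of [W'] span [V] modulo [W'], and the [u t] span [W'] modulo
    [W]; together they span [V] modulo [W]. *)
Lemma codim_le_add W W' d d' (T : finType) (u : T -> V) :
  codim W d -> codim W' d' ->
  (forall v, W' v -> exists c : T -> k, W (v - \sum_t c t *: u t)) ->
  (d <= d' + #|T|)%N.
Proof.
move=> cW [F [linF kerF surjF]] span.
have /choice[g Fg] : forall j : 'I_d', exists v, forall i, F i v = (i == j)%:R.
  by move=> j; exact: surjF.
rewrite -[d']card_ord -card_sum.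
apply: (codim_span (u := fun x => match x with inl j => g j | inr t => u t end) cW).
move=> v; have /span[c Wc] : W' (v - \sum_j F j v *: g j).
  apply/kerF => i; rewrite scalarB // scalar_lincomb //.
  rewrite (bigD1 i) //= Fg eqxx mulr1 big1 ?addr0 ?subrr // => j ji.
  by rewrite Fg eq_sym (negPf ji) mulr0.
exists (fun x => match x with inl j => F j v | inr t => c t end).
by rewrite big_sumType /= opprD addrA.
Qed.

Lemma codim_le W W' d d' : codim W d -> codim W' d' -> W `<=` W' -> (d' <= d)%N.
Proof.
move=> cW cW' sWW'; rewrite -[d]addn0 -[X in (_ <= _ + X)%N](card_ord 0).
apply: (codim_le_add (u := fun=> 0) cW' cW) => v Wv.
by exists (fun=> 0); rewrite big_ord0 subr0; exact: sWW'.
Qed.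

Lemma codim_uniq W d d' : codim W d -> codim W d' -> d = d'.
Proof.
by move=> c c'; apply/eqP; rewrite eqn_leq (codim_le c' c) // (codim_le c c').
Qed.

Lemma codim_lt W W' d d' : codim W d -> codim W' d' -> W `<` W' -> (d' < d)%N.
Proof.
move=> cW cW' [sWW' nW'W].
have /existsNP[w /not_implyP[W'w nWw]] := nW'W.
have [d0 cWw] := codim_add_line cW nWw.
rewrite -(prednK d0) ltnS; apply: (codim_le cWw cW') => v [c Wv].
have [_ lW'] := codim_subspace cW'.
by rewrite -[v](subrK (c *: w)) addrC; apply: lW' => //; exact: sWW'.
Qed.

End Codimension.

(** The jointly surjective maps [f a] identify V/WV with the direct sum of the quotients of [U] by
    the [WU a]. The functionals for [WV] are those of the summands, pulled back. *)
Lemma codim_preimages (k : fieldType) (V U : lmodType k) (A : finType)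
    (d : A -> nat) (f : A -> V -> U) (WU : A -> set U) (WV : set V) :
  (forall a, linear (f a)) -> (forall a, codim (WU a) (d a)) ->
  (forall u : A -> U, exists v, forall a, f a v = u a) ->
  (forall v, WV v <-> forall a, WU a (f a v)) ->
  codim WV (\sum_a d a).
Proof.
move=> linf cWU surjf WVE.
pose F a := sval (cid (cWU a)); have HF a := svalP (cid (cWU a)).
have -> : (\sum_a d a = #|{: {a : A & 'I_(d a)}}|)%N.
  rewrite card_tagged sumnE big_map big_enum; apply: eq_bigr => a _.
  by rewrite card_ord.
apply: (codim_fintype (F := fun (t : {a : A & 'I_(d a)}) v =>
  F (tag t) (tagged t) (f (tag t) v))).
- by move=> [a i] c u v /=; have [linF _ _] := HF a; rewrite linf; exact: linF.
- move=> v; rewrite WVE; split=> [Wv [a i]|Fv a]; have [_ kerF _] := HF a.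
    by move: i => /=; apply/kerF.
  by apply/kerF => i; exact: (Fv (Tagged _ i)).
- move=> y; have /choice[u Fu] : forall a, exists u, forall i, F a i u = y (Tagged _ i).
    by move=> a; have [_ _ ] := HF a; apply.
  have [v fv] := surjf u; exists v => -[a i] /=; rewrite fv; exact: Fu.
Qed.

(** * Ideals generated by powers of the variables and one polynomial *)

Lemma ideal_subspace (k : fieldType) s (J : set (mpoly s k)) :
  is_ideal J -> is_subspace J.
Proof.
move=> [J0 Jadd Jmul]; split=> // a u v Ju Jv; apply: Jadd => //.
by rewrite -mul_mpolyC; exact: Jmul.
Qed.

Lemma ideal_sum (A : comNzRingType) (J : set A) (T : Type) (r : seq T)
    (P : pred T) (F : T -> A) :
  is_ideal J -> (forall t, P t -> J (F t)) -> J (\sum_(t <- r | P t) F t).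
Proof. by move=> [J0 Jadd _] JF; apply: (big_ind J). Qed.

Lemma ideal_genP (A : comNzRingType) (X : set A) : is_ideal (ideal_gen X).
Proof.
split=> [J [[]] //|x y Xx Xy J JX|a x Xx J JX].
- by have [[_ Jadd _] _] := JX; apply: Jadd; [exact: Xx | exact: Xy].
- by have [[_ _ Jmul] _] := JX; apply: Jmul; exact: Xx.
Qed.

Lemma card_dffun_ord s (c : 'I_s -> nat) :
  #|{dffun forall i, 'I_(c i)}| = (\prod_i c i)%N.
Proof.
rewrite card_dep_ffun foldrE big_map big_enum /=.
by apply: eq_bigr => i _; rewrite card_ord.
Qed.

Section Box.
Context {k : fieldType} {s : nat}.
Implicit Types (c n a : 'I_s -> nat) (m : multinom s) (g h psi : mpoly s k).

Definition mnm_of (f : 'I_s -> nat) : multinom s := Multinom [tuple f i | i < s].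

Lemma mnm_ofE f i : mnm_of f i = f i.
Proof. exact: mnmE. Qed.

Lemma mnm_neq0 m : m != mnm0 -> exists i, m i != 0%N.
Proof.
move=> m0; apply/existsP; apply: contraNT m0; rewrite negb_exists => /forallP m0.
by apply/eqP/mnmP => i; rewrite mnm0E; apply/eqP; have := m0 i; rewrite negbK.
Qed.

Definition box c m := [forall i, (m i < c i)%N].

Lemma mem_box c (b : {dffun forall i, 'I_(c i)}) : box c (mnm_of (fun i => b i)).
Proof. by apply/forallP => i; rewrite mnm_ofE. Qed.

Lemma box_memP c m : box c m ->
  exists b : {dffun forall i, 'I_(c i)}, m = mnm_of (fun i => b i).
Proof.
move=> /forallP bm; exists [ffun i => Ordinal (bm i)].
by apply/mnmP => i; rewrite mnm_ofE ffunE.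
Qed.

Lemma mnm_of_inj c : injective
  (fun b : {dffun forall i, 'I_(c i)} => mnm_of (fun i => b i)).
Proof.
move=> b b' /mnmP bb'; apply/ffunP => i; apply: val_inj.
by have := bb' i; rewrite !mnm_ofE.
Qed.

Lemma mcoeffMX_neq g m m' : (forall u, m' <> mnm_add m u) ->
  mcoeff m' (g * mpolyX k m) = 0.
Proof.
move=> neq; apply/eqP; rewrite mcoeff_eq0 (perm_mem (msuppMX _ _)).
by apply/mapP => -[u _ E]; exact: (neq u).
Qed.

(* The ideal generated by the powers mvar k i ^+ c i. *)
Definition box_ideal c : set (mpoly s k) :=
  [set g | forall m, box c m -> mcoeff m g = 0].

Lemma box_ideal_is_ideal c : is_ideal (box_ideal c).
Proof.
split=> [m _|g h bg bh m bm|g h bh m bm].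
- exact: mcoeff0.
- by rewrite mcoeffD bg ?bh ?addr0.
- rewrite mcoeffM big1 // => -[/= m1 m2] /eqP mE.
  rewrite (bh m2) ?mulr0 //; apply/forallP => i.
  have /mnmP/(_ i) := mE; rewrite mnmDE => mi.
  by apply: leq_ltn_trans (forallP bm i); rewrite mi leq_addl.
Qed.

(** Each monomial occurring in an element of [box_ideal c] lies outside the box, so it is divisible
    by some [mvar k i ^+ c i]. *)
Lemma box_ideal_sub c (J : set (mpoly s k)) : is_ideal J ->
  (forall i, J (mvar k i ^+ c i)) -> box_ideal c `<=` J.
Proof.
move=> idJ Jc g bg; have [_ _ Jmul] := idJ.
rewrite [g]mpolyE; apply: ideal_sum => // m _.
have [/bg ->|] := boolP (box c m); first by rewrite scale0r; case: idJ.
rewrite negb_forall => /existsP[i]; rewrite -leqNgt => ci.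
pose u := mnm_muln (mnm1 i) (c i).
have um : mnm_add (mnm_sub m u) u = m.
  apply: submK; apply/mnm_lepP => j; rewrite mulmnE mnm1E.
  by case: eqP => [<-|_]; rewrite ?mul1n ?mul0n.
rewrite -um mpolyXD -mul_mpolyC mulrA -mpolyXn.
by apply: Jmul; exact: Jc.
Qed.

Lemma box_ideal_power c i : box_ideal c (mvar k i ^+ c i).
Proof.
move=> m /forallP/(_ i); rewrite mpolyXn mcoeffX; case: eqP => // <-.
by rewrite mulmnE mnm1E eqxx mul1n ltnn.
Qed.

Lemma box_ideal_le c c' : (forall i, c' i <= c i)%N -> box_ideal c `<=` box_ideal c'.
Proof.
move=> cc g bg m /forallP bm; apply: bg; apply/forallP => i.
exact: leq_trans (bm i) (cc i).
Qed.

Lemma codim_box c : codim (box_ideal c) (\prod_i c i).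
Proof.
rewrite -card_dffun_ord.
apply: (codim_fintype (F := fun (b : {dffun forall i, 'I_(c i)}) g =>
  mcoeff (mnm_of (fun i => b i)) g)) => [b x u v|g|y].
- by rewrite mcoeffD mcoeffZ.
- split=> [bg b|gb m /box_memP[b ->]]; last exact: gb.
  by apply: bg; exact: mem_box.
- exists (\sum_b y b *: mpolyX k (mnm_of (fun i => (b : {dffun forall i, 'I_(c i)}) i))) => b.
  rewrite raddf_sum (bigD1 b) //= mcoeffZ mcoeffX eqxx mulr1.
  rewrite big1 ?addr0 // => b' /negPf bb'.
  by rewrite mcoeffZ mcoeffX (inj_eq (@mnm_of_inj c)) bb' mulr0.
Qed.

(* The ideal generated by psi and the powers mvar k i ^+ c i. *)
Definition box_ideal_with c psi : set (mpoly s k) :=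
  [set g | exists h, box_ideal c (g - h * psi)].

Lemma box_ideal_with_is_ideal c psi : is_ideal (box_ideal_with c psi).
Proof.
have [b0 badd bmul] := box_ideal_is_ideal c.
split=> [|g g' [h bh] [h' bh']|x g [h bh]].
- by exists 0; rewrite mul0r subr0.
- by exists (h + h'); rewrite mulrDl opprD addrACA; exact: badd.
- by exists (x * h); rewrite -mulrA -mulrBr; exact: bmul.
Qed.

Lemma box_ideal_with_box c psi : box_ideal c `<=` box_ideal_with c psi.
Proof. by move=> g bg; exists 0; rewrite mul0r subr0. Qed.

Lemma box_ideal_with_gen c psi : box_ideal_with c psi psi.
Proof. by exists 1; rewrite mul1r subrr; have [] := box_ideal_is_ideal c. Qed.

Lemma box_ideal_with_sub c psi (J : set (mpoly s k)) : is_ideal J ->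
  (forall i, J (mvar k i ^+ c i)) -> J psi -> box_ideal_with c psi `<=` J.
Proof.
move=> idJ Jc Jpsi g [h bh]; have [_ Jadd Jmul] := idJ.
rewrite -[g](subrK (h * psi)); apply: Jadd; last exact: Jmul.
exact: box_ideal_sub bh.
Qed.

(** The default 0 is never taken: the ideal contains [box_ideal c], which has finite codimension. *)
Definition box_length c psi : nat := xget 0%N (codim (box_ideal_with c psi)).

Lemma codim_box_ideal_with c psi :
  codim (box_ideal_with c psi) (box_length c psi).
Proof.
apply: xgetPex; apply: codim_superset (codim_box c) _ _.
  exact: box_ideal_with_box.
exact/ideal_subspace/box_ideal_with_is_ideal.
Qed.

Lemma box_length_unique c psi d : codim (box_ideal_with c psi) d -> box_length c psi = d.
Proof. exact: codim_uniq (codim_box_ideal_with c psi). Qed.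

Lemma box_length_le c c' psi e e' : (forall i, c' i <= c i)%N -> (e' <= e)%N ->
  (box_length c' (psi ^+ e') <= box_length c (psi ^+ e))%N.
Proof.
move=> cc ee; apply: codim_le; try exact: codim_box_ideal_with.
apply: box_ideal_with_sub; first exact: box_ideal_with_is_ideal.
- move=> i; apply/box_ideal_with_box/(box_ideal_le cc)/box_ideal_power.
- rewrite -(subnK ee) exprD; have [_ _] := box_ideal_with_is_ideal c' (psi ^+ e').
  by apply; exact: box_ideal_with_gen.
Qed.

Lemma card_box_sub c c' : (forall i, c' i <= c i)%N ->
  (#|{: {b : {dffun forall i, 'I_(c i)} | ~~ box c' (mnm_of (fun i => b i))}}|
     + \prod_i c' i <= \prod_i c i)%N.
Proof.
move=> cc; rewrite card_sig -!card_dffun_ord.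
pose w (b : {dffun forall i, 'I_(c' i)}) : {dffun forall i, 'I_(c i)} :=
  [ffun i => widen_ord (cc i) (b i)].
have w_inj : injective w.
  move=> b b' /ffunP ww; apply/ffunP => i; have := ww i; rewrite !ffunE.
  by move=> /(congr1 val) /= /val_inj.
rewrite -(card_imset _ w_inj).
rewrite -(cardC [pred b : {dffun forall i, 'I_(c i)} | ~~ box c' (mnm_of (fun i => b i))]).
rewrite leq_add2l; apply: subset_leq_card; apply/fintype.subsetP => _ /imsetP[b _ ->].
rewrite !inE negbK; apply/forallP => i.
by rewrite mnm_ofE ffunE /=; exact: ltn_ord.
Qed.

(** Modulo the ideal for [c], the ideal for [c'] is spanned by the monomials in the box of [c]
    outside that of [c']. Hence the two lengths differ by at most the difference of the box volumes,
    whatever [psi] is. *)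
Lemma box_length_sub_le c c' psi : (forall i, c' i <= c i)%N ->
  (box_length c psi + \prod_i c' i <= box_length c' psi + \prod_i c i)%N.
Proof.
move=> cc; apply: leq_trans (leq_add (leqnn _) (card_box_sub cc)).
rewrite addnA leq_add2r.
pose T := {b : {dffun forall i, 'I_(c i)} | ~~ box c' (mnm_of (fun i => b i))}.
pose mT (t : T) := mnm_of (fun i => val t i).
have mT_inj : injective mT by move=> t t' /mnm_of_inj /val_inj.
apply: (codim_le_add (u := fun t => mpolyX k (mT t))); try exact: codim_box_ideal_with.
move=> g [h bh]; exists (fun t => mcoeff (mT t) (g - h * psi)).
exists h => m bm; rewrite addrAC mcoeffB raddf_sum /=.
have [bm'|nbm'] := boolP (box c' m).
  rewrite bh // big1 ?subr0 // => t _; rewrite mcoeffZ mcoeffX.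
  by case: eqP => [E|]; rewrite ?mulr0 //; have := valP t; rewrite -/(mT t) E bm'.
have [b mE] := box_memP bm.
have bT : ~~ box c' (mnm_of (fun i => b i)) by rewrite -mE.
pose t : T := exist _ b bT.
have -> : m = mT t by [].
rewrite (bigD1 t) //= mcoeffZ mcoeffX eqxx mulr1 big1 ?addr0 ?subrr // => t' /negPf tt'.
by rewrite mcoeffZ mcoeffX (inj_eq mT_inj) tt' mulr0.
Qed.

End Box.

(** * Decomposition over the subring of the powers x_i ^+ n i *)

Section Decomposition.
Context {k : fieldType} {s : nat}.
Implicit Types (c n a : 'I_s -> nat) (m : multinom s) (g h : mpoly s k).

Definition dilate n a m : multinom s := mnm_of (fun i => a i + n i * m i)%N.

Lemma dilateE n a m i : dilate n a m i = (a i + n i * m i)%N.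
Proof. exact: mnm_ofE. Qed.

(* Over the subring of polynomials in the x_i ^+ n i, the monomials x ^ a with
   a i < n i form a basis; this is the coordinate of g along x ^ a, with
   x_i ^+ n i renamed to x_i. *)
Definition coord n a g : mpoly s k :=
  \sum_(m : bmultinom s (mmeasure mdeg g)) mcoeff (dilate n a m) g *: mpolyX k m.

Variable n : 'I_s -> nat.
Hypothesis n_gt0 : forall i, (0 < n i)%N.

(** The degree bound in the sum defining [coord] loses nothing: as the [n i] are positive, [dilate]
    does not lower degrees. *)
Lemma mcoeff_coord a g m : mcoeff m (coord n a g) = mcoeff (dilate n a m) g.
Proof.
have [lt_mg|le_gm] := ltnP (mdeg m) (mmeasure mdeg g).
  exact: (mcoeff_mpoly (fun m => mcoeff (dilate n a m) g)).
have -> : mcoeff (dilate n a m) g = 0.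
  apply: memN_msupp_eq0; apply: msize_mdeg_ge; apply: leq_trans le_gm _.
  rewrite !mdegE; apply: leq_sum => i _; rewrite mnm_ofE.
  by apply: leq_trans (leq_addl _ _); rewrite leq_pmull.
rewrite /coord raddf_sum big1 //= => m' _; rewrite mcoeffZ mcoeffX.
case: eqP => [m'm|]; last by rewrite mulr0.
by have := bmdeg m'; rewrite m'm ltnNge le_gm.
Qed.

Lemma coord_linear a : linear (coord n a).
Proof.
by move=> x g h; apply/mpolyP => m; rewrite mcoeffD mcoeffZ !mcoeff_coord mcoeffD mcoeffZ.
Qed.

Lemma coord_mul_var a i h : (a i < n i)%N ->
  coord n a (h * mvar k i ^+ n i) = coord n a h * mvar k i.
Proof.
move=> lt_an; apply/mpolyP => m; rewrite mcoeff_coord mpolyXn.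
have [mi0|mi_gt0] := posnP (m i).
  (* Both coefficients vanish: x_i does not divide [m], and its exponent in the dilated monomial is
     [a i], less than [n i]. *)
  rewrite !mcoeffMX_neq // => u /mnmP/(_ i).
    by rewrite mi0 mnmDE mnm1E eqxx.
  rewrite mnm_ofE mi0 muln0 addn0 mnmDE mulmnE mnm1E eqxx mul1n => E.
  by rewrite E ltnNge leq_addr in lt_an.
have um : mnm_add (mnm1 i) (mnm_sub m (mnm1 i)) = m.
  by rewrite addmC; apply: submK; rewrite lep1mP -lt0n.
have -> : dilate n a m =
    mnm_add (mnm_muln (mnm1 i) (n i)) (dilate n a (mnm_sub m (mnm1 i))).
  apply/mnmP => j; rewrite mnmDE !dilateE mulmnE.
  have -> : m j = (mnm1 i j + mnm_sub m (mnm1 i) j)%N by rewrite -[in LHS]um mnmDE.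
  rewrite mnm1E mulnDr addnCA; congr (_ + _)%N.
  by case: eqP => [->|_]; rewrite ?mul1n ?muln1 ?muln0.
by rewrite -[in RHS]um !mcoeffMX mcoeff_coord.
Qed.

Lemma coord_mul_pow a e h : (forall i, a i < n i)%N ->
  coord n a (h * (\sum_i mvar k i ^+ n i) ^+ e) = coord n a h * (\sum_i mvar k i) ^+ e.
Proof.
move=> lt_an; elim: e h => [|e IHe] h; first by rewrite !expr0 !mulr1.
rewrite !exprSr !mulrA -IHe; apply/mpolyP => m.
rewrite mulr_sumr mcoeff_coord raddf_sum /= mulr_sumr raddf_sum /=.
by apply: eq_bigr => i _; rewrite -mcoeff_coord coord_mul_var.
Qed.

Lemma dilate_inj a a' m m' : (forall i, a i < n i)%N -> (forall i, a' i < n i)%N ->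
  dilate n a m = dilate n a' m' -> a =1 a' /\ m = m'.
Proof.
move=> an an' /mnmP E.
have aE i : (a i + n i * m i = a' i + n i * m' i)%N.
  by have := E i; rewrite !mnm_ofE.
split=> [i|].
  by have /(congr1 (modn^~ (n i))) := aE i;
    rewrite ![(_ + n i * _)%N]addnC ![(n i * _)%N]mulnC !modnMDl !modn_small.
apply/mnmP => i; have /(congr1 (divn^~ (n i))) := aE i.
by rewrite ![(_ + n i * _)%N]addnC ![(n i * _)%N]mulnC !divnMDl // !divn_small // !addn0.
Qed.

Lemma coord_surj (u : {dffun forall i, 'I_(n i)} -> mpoly s k) :
  exists h, forall a : {dffun forall i, 'I_(n i)}, coord n (fun i => a i) h = u a.
Proof.
(* This is the sum over a of x^a u_a(x_1^n_1, ..., x_s^n_s). *)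
exists (\sum_(a : {dffun forall i, 'I_(n i)}) \sum_(m <- msupp (u a))
  mcoeff m (u a) *: mpolyX k (dilate n (fun i => a i) m)) => a.
apply/mpolyP => m; rewrite mcoeff_coord raddf_sum (bigD1 a) //= [X in _ + X]big1.
  rewrite addr0 raddf_sum /= [in RHS](mpolyE (u a)) raddf_sum /=.
  apply: eq_bigr => m' _; rewrite !mcoeffZ !mcoeffX; congr (_ * (nat_of_bool _)%:R).
  apply/eqP/eqP => [/dilate_inj[] //|-> //] _ //.
move=> a' /eqP aa'; rewrite raddf_sum big1 //= => m' _; rewrite mcoeffZ mcoeffX.
case: eqP => [/dilate_inj[] // E _|]; last by rewrite mulr0.
by case: aa'; apply/ffunP => i; apply: val_inj; exact: E.
Qed.

(** The hypothesis characterizes [c a i] as max(0, ceil((N_i - a_i)/n_i)): exactly then does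
    [dilate] send the box of [c a], and nothing outside it, into the box of [N]. *)
Lemma box_length_decomposition N (c : {dffun forall i, 'I_(n i)} -> 'I_s -> nat) e :
  (forall (a : {dffun forall i, 'I_(n i)}) i x,
     (N i <= a i + n i * x)%N = (c a i <= x)%N) ->
  box_length N ((\sum_i mvar k i ^+ n i) ^+ e) =
  (\sum_a box_length (c a) ((\sum_i mvar k i) ^+ e))%N.
Proof.
move=> cE; apply: box_length_unique.
have box_dilate (a : {dffun forall i, 'I_(n i)}) m :
    box N (dilate n (fun i => a i) m) = box (c a) m.
  by apply: eq_forallb => i; rewrite mnm_ofE !ltnNge cE.
have lt_an (a : {dffun forall i, 'I_(n i)}) i : (a i < n i)%N by [].
apply: (codim_preimages (f := fun a : {dffun forall i, 'I_(n i)} =>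
    coord n (fun i => a i))).
- by move=> a; exact: coord_linear.
- by move=> a; exact: codim_box_ideal_with.
- exact: coord_surj.
move=> g; split=> [[h bh] a|].
  exists (coord n (fun i => a i) h) => m bm.
  rewrite -coord_mul_pow // mcoeffB !mcoeff_coord -mcoeffB.
  by apply: bh; rewrite box_dilate.
(* The cofactors [u a] found in the separate coordinates are the coordinates of one [h]. Dividing
   each [m i] by [n i] tells which coordinate holds the coefficient at [m]. *)
move=> /choice[u bu]; have [h hu] := coord_surj u; exists h => m bm.
pose a : {dffun forall i, 'I_(n i)} := [ffun i => Ordinal (ltn_pmod (m i) (n_gt0 i))].
have mE : m = dilate n (fun i => a i) (mnm_of (fun i => m i %/ n i)%N).
  by apply/mnmP => i; rewrite !mnm_ofE ffunE /= addnC mulnC -divn_eq.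
have := bu a (mnm_of (fun i => m i %/ n i)%N).
rewrite -hu -coord_mul_pow // !mcoeffB !mcoeff_coord -mE; apply.
by rewrite -box_dilate -mE.
Qed.

End Decomposition.

(** * Scaling of lengths under Frobenius *)

Lemma sum_vars_frobenius (k : fieldType) s p : p \in [pchar k] ->
  (\sum_i mvar k i : mpoly s k) ^+ p = \sum_i mvar k i ^+ p.
Proof.
move=> pk; have pA : p \in [pchar (mpoly s k)] by rewrite pchar_lalg.
rewrite -(pFrobenius_autE pA) rmorph_sum /=.
by apply: eq_bigr => i _; rewrite pFrobenius_autE.
Qed.

Lemma box_length_frobenius (k : fieldType) s p (c : 'I_s -> nat) e :
  p \in [pchar k] ->
  box_length (fun i => p * c i)%N ((\sum_i mvar k i) ^+ (p * e)) =
  (p ^ s * box_length c ((\sum_i mvar k i) ^+ e))%N.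
Proof.
move=> pk; have p_gt0 := prime_gt0 (pcharf_prime pk).
rewrite exprM sum_vars_frobenius //.
rewrite (@box_length_decomposition _ _ (fun=> p) _ _ (fun=> c)) => [|//|a i x].
  by rewrite sum_nat_const card_dffun_ord prod_nat_const card_ord.
(* Since 0 <= a_i < p, rounding (p c_i - a_i)/p up gives c_i: all p^s summands have the same
   exponents. *)
have [lt_xc|le_cx] := ltnP x (c i).
  apply/negbTE; rewrite -ltnNge; apply: (@leq_trans (p * x.+1)).
    by rewrite mulnS ltn_add2r.
  by rewrite leq_mul2l lt_xc orbT.
by apply: leq_trans (leq_addl _ _); rewrite leq_mul2l le_cx orbT.
Qed.

(** * Length and codimension *)

Section Colength.
Context {k : fieldType} {s : nat}.
Implicit Types (c : 'I_s -> nat) (m : multinom s) (J : set (mpoly s k)).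

Lemma box_ideal_monomial c m : ~~ box c m -> box_ideal c (mpolyX k m).
Proof.
move=> nbm m' bm'; rewrite mcoeffX; case: eqP => // E.
by rewrite E bm' in nbm.
Qed.

(** Multiplication by variables is repeated while the monomial stays outside [J]. It ends because
    monomials outside [J] lie in the box and so have bounded degree. *)
Lemma exists_socle_monomial c J m : box_ideal c `<=` J -> ~ J (mpolyX k m) ->
  exists2 m', ~ J (mpolyX k m') & forall i, J (mpolyX k (mnm_add (mnm1 i) m')).
Proof.
move=> bJ nJm.
have deg_lt m' : ~ J (mpolyX k m') -> (mdeg m' <= \sum_i c i)%N.
  move=> nJm'; have /forallP bm' : box c m'.
    by apply/negP => /negP /box_ideal_monomial /bJ.
  by rewrite mdegE; apply: leq_sum => i _; exact: ltnW.
move: {-1}(\sum_i c i - mdeg m)%N (leqnn (\sum_i c i - mdeg m)%N) => t.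
elim: t m nJm => [|t IHt] m nJm tm.
all: have [Jm|/existsNP[i nJi]] := pselect (forall i, J (mpolyX k (mnm_add (mnm1 i) m)));
  first by exists m.
all: have := deg_lt _ nJi; rewrite mdegD mdeg1 add1n => lt_m.
  by move: tm; rewrite leqn0 subn_eq0 leqNgt lt_m.
by apply: (IHt _ nJi); rewrite mdegD mdeg1 add1n subnS -ltnS prednK // subn_gt0.
Qed.

(** Every nonconstant monomial sends x^m into [J], so modulo [J] a polynomial acts on x^m through
    its constant term. *)
Lemma add_line_ideal J m : is_ideal J -> ~ J (mpolyX k m) ->
  (forall i, J (mpolyX k (mnm_add (mnm1 i) m))) ->
  is_ideal (add_line J (mpolyX k m)).
Proof.
move=> idJ nJm Jm; have [J0 Jadd Jmul] := idJ.
have lJ := ideal_subspace idJ.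
have [L0 Llin] : is_subspace (add_line J (mpolyX k m)).
  split; first by exists 0; rewrite scale0r subr0.
  move=> a u v [x Ju] [y Jv]; exists (a * x + y).
  rewrite scalerDl opprD addrACA -scalerA -scalerBr; exact: (proj2 lJ).
have LJ g : J g -> add_line J (mpolyX k m) g by exists 0; rewrite scale0r subr0.
split=> [//|x y Lx Ly|a x [e Jx]].
  by rewrite -[x]scale1r; exact: Llin.
rewrite -[x](subrK (e *: mpolyX k m)) mulrDr -[a * _]scale1r.
apply: (Llin); first by apply: LJ; exact: Jmul.
rewrite -scalerAr -[_ *: _]addr0; apply: (Llin) => //.
rewrite [a]mpolyE mulr_suml; apply: subspace_sum => // m' _.
rewrite -scalerAl -[_ *: _]addr0; apply: (Llin) => //.
have [->|m'0] := eqVneq m' mnm0.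
  by rewrite mpolyX0 mul1r; exists 1; rewrite scale1r subrr.
have [i m'i] := mnm_neq0 m'0.
apply: LJ; rewrite -(submK (m := mnm1 i) (m' := m')) ?lep1mP //.
by rewrite mpolyXD -mulrA -mpolyXD; exact: Jmul.
Qed.

(** Adjoining a socle monomial gives a larger ideal of codimension one less; iterating this builds
    the chain. *)
Lemma has_chain_codim c J d : is_ideal J -> box_ideal c `<=` J -> codim J d ->
  has_chain [set L | is_ideal L /\ J `<=` L] d.
Proof.
elim: d J => [|d IHd] J idJ bJ cJ.
  by exists (fun=> J); split=> [i _|//]; split.
(* Otherwise [J] would be the whole ring, whose codimension is 0. *)
have [m nJm] : exists m, ~ J (mpolyX k m).
  apply: contrapT => /forallNP JX; have [F [linF kerF surjF]] := cJ.
  have [g Fg] := surjF (fun=> 1); have /kerF/(_ ord0) : J g.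
    rewrite [g]mpolyE; apply: subspace_sum; first exact: ideal_subspace.
    move=> m _; rewrite -mul_mpolyC; have [_ _ Jmul] := idJ; apply: Jmul.
    by apply: contrapT; exact: JX.
  by rewrite Fg => /eqP; rewrite oner_eq0.
have {m nJm}[m nJm Jm] := exists_socle_monomial bJ nJm.
have idL := add_line_ideal idJ nJm Jm.
have [_ /= cL] := codim_add_line cJ nJm.
have JL : J `<=` add_line J (mpolyX k m).
  by move=> g Jg; exists 0; rewrite scale0r subr0.
have [C [CL Clt]] := IHd _ idL (subset_trans bJ JL) cL.
exists (fun i => if i is i'.+1 then C i' else J); split.
  by case=> [_|i /CL[idC LC]]; split=> //; exact: subset_trans JL LC.
case=> [_|i]; last exact: Clt.
have [_ LC] := CL 0%N (leq0n d); split; first exact: subset_trans JL LC.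
move=> CJ; apply/nJm/CJ/LC; exists 1; rewrite scale1r subrr.
by case: idJ.
Qed.

(** A chain of length [d] exists by [has_chain_codim], and none is longer because the codimension
    drops strictly along a chain. *)
Lemma colength_codim (R : realType) c J d : is_ideal J -> box_ideal c `<=` J ->
  codim J d -> colength R J = (d%:R)%:E.
Proof.
move=> idJ bJ cJ; apply/eqP; rewrite eq_le; apply/andP; split; last first.
  by apply: ereal_sup_ubound; exists d => //; exact: has_chain_codim idJ bJ cJ.
apply: ge_ereal_sup => _ [l [C [CS Clt]] <-]; rewrite lee_fin ler_nat.
suff H i : (i <= l)%N -> exists2 e, codim (C i) e & (e + i <= d)%N.
  by have [e _] := H l (leqnn l); apply: leq_trans; rewrite leq_addl.
elim: i => [_|i IHi lt_il].
  have [idC JC] := CS 0%N (leq0n l).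
  have [e cC] := codim_superset cJ JC (ideal_subspace idC).
  by exists e => //; rewrite addn0; exact: codim_le JC.
have [e cC le_d] := IHi (ltnW lt_il); have [idC JC] := CS i.+1 lt_il.
have [e' cC'] := codim_superset cJ JC (ideal_subspace idC).
exists e' => //; apply: leq_trans le_d; rewrite addnS ltn_add2r.
exact: codim_lt (Clt i lt_il).
Qed.

End Colength.

(** * The dimension at the origin *)

Lemma kernel_prime (A : comNzRingType) (B : idomainType) (f : {rmorphism A -> B}) :
  is_prime [set x | f x = 0].
Proof.
split=> [|/=|x y /= /eqP]; first split=> /= [|x y fx fy|a x fx].
- exact: rmorph0.
- by rewrite rmorphD fx fy addr0.
- by rewrite rmorphM fx mulr0.
- by rewrite rmorph1 => /eqP; rewrite oner_eq0.
- by rewrite rmorphM mulf_eq0 => /orP[] /eqP; [left|right].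
Qed.

Section Dimension.
Context {k : fieldType} {s : nat}.
Implicit Types (g h : mpoly s k) (D : nat).

Definition maximal_at_0 : set (mpoly s k) := [set g | meval (fun=> 0) g = 0].

Lemma meval_at_0 g : meval (fun=> 0) g = mcoeff mnm0 g.
Proof.
rewrite mevalE [in RHS](mpolyE g) raddf_sum /=; apply: eq_bigr => m _.
rewrite mcoeffZ mcoeffX; congr (_ * _).
have [->|m0] := eqVneq m mnm0; first by rewrite big1 // => i _; rewrite mnm0E expr0.
have [i mi] := mnm_neq0 m0.
by rewrite (bigD1 i) //= expr0n (negPf mi) mul0r.
Qed.

Lemma radical_maximal_at_0 (X : set (mpoly s k)) :
  X `<=` maximal_at_0 -> (forall i, ideal_gen X (mvar k i)) ->
  radical (ideal_gen X) = maximal_at_0.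
Proof.
move=> XM varX; apply/seteqP; split=> g.
  move=> [e Xge]; have [idM _ _] := kernel_prime (meval (fun=> 0) : {rmorphism mpoly s k -> k}).
  have /= := smallest_sub idM XM Xge; rewrite rmorphXn /= => /eqP.
  by rewrite expf_eq0 => /andP[_ /eqP].
move=> Mg; exists 1%N; rewrite expr1.
(* With all exponents 1 the box holds only the monomial 1, so vanishing of the constant term is the
   whole condition. *)
apply: (box_ideal_sub (c := fun=> 1%N) (ideal_genP _)) => [i|m /forallP bm].
  by rewrite expr1.
rewrite (_ : m = mnm0) -?meval_at_0 //; apply/mnmP => i; rewrite mnm0E.
by have := bm i; case: (m i).
Qed.

Definition kill_vars (i : nat) : mpoly s k -> mpoly s k :=
  comp_mpoly [tuple if (j < i)%N then 0 else mvar k j | j < s].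

Lemma kill_vars_mvar i j : kill_vars i (mvar k j) = if (j < i)%N then 0 else mvar k j.
Proof. by rewrite /kill_vars /mvar comp_mpolyXU -tnth_nth tnth_mktuple. Qed.

Lemma kill_vars_kill_vars i j g : (i <= j)%N -> kill_vars j (kill_vars i g) = kill_vars j g.
Proof.
move=> ij; rewrite {2}/kill_vars [X in kill_vars j X]comp_mpolyE /kill_vars raddf_sum /=.
rewrite [RHS]comp_mpolyE; apply: eq_bigr => m _.
rewrite linearZ /= rmorph_prod /=; congr (_ *: _); apply: eq_bigr => l _.
rewrite rmorphXn /=; congr (_ ^+ _); rewrite !tnth_mktuple.
have [li|_] := ltnP l i; last by rewrite -/(kill_vars j _) kill_vars_mvar.
by rewrite (leq_trans li ij) rmorph0.
Qed.

(** The chain is 0 < (x_1) < (x_1, x_2) < ... < (x_1, ..., x_s), each prime being the kernel of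
    setting the first [i] variables to 0. *)
Lemma has_chain_maximal_at_0 :
  has_chain [set P | is_prime P /\ P `<=` maximal_at_0] s.
Proof.
exists (fun i => [set g | kill_vars i g = 0]); split=> i lt_is.
  split; first exact: (kernel_prime (kill_vars i)).
  move=> g /= gi; have := congr1 (meval (fun=> 0)) gi.
  rewrite meval0 comp_mpoly_meval /maximal_at_0 /= => g0; rewrite -[RHS]g0.
  apply: meval_eq => j; rewrite tnth_mktuple.
  by case: ifP => _; rewrite ?meval0 // mevalXU.
split=> [g /= gi|/(_ (mvar k (Ordinal lt_is)))/=].
  by rewrite -(kill_vars_kill_vars _ (leqnSn i)) gi /kill_vars rmorph0.
rewrite !kill_vars_mvar /= ltnSn ltnn => /(_ erefl) /(congr1 (mcoeff (mnm1 (Ordinal lt_is)))).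
by rewrite mcoeff0 mcoeffX eqxx => /eqP; rewrite oner_eq0.
Qed.

Definition degree_le D g := forall m, (D < mdeg m)%N -> mcoeff m g = 0.

Lemma degree_le_msize g : degree_le (mmeasure mdeg g) g.
Proof. by move=> m /ltnW gm; apply: memN_msupp_eq0; exact: msize_mdeg_ge. Qed.

Lemma degree_le_trans D D' g : (D <= D')%N -> degree_le D g -> degree_le D' g.
Proof. by move=> DD' gD m /(leq_ltn_trans DD'); exact: gD. Qed.

Lemma degree_le_mul D D' g h : degree_le D g -> degree_le D' h -> degree_le (D + D') (g * h).
Proof.
move=> gD hD' m lt_m; rewrite mcoeffM big1 // => -[/= m1 m2] /eqP /(congr1 mdeg).
rewrite mdegD => mE; have [/gD->|le_m1] := ltnP D (mdeg m1); first by rewrite mul0r.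
rewrite hD' ?mulr0 // -(ltn_add2l D); apply: (leq_trans lt_m).
by apply: leq_trans (eq_leq mE) _; rewrite leq_add2r.
Qed.

Lemma degree_le_exp D g e : degree_le D g -> degree_le (e * D) (g ^+ e).
Proof.
move=> gD; elim: e => [|e IHe]; last by rewrite exprS mulSn; exact: degree_le_mul.
move=> m; rewrite mul0n lt0n mdeg_eq0 => /negPf m0.
by rewrite expr0 mcoeff1 m0.
Qed.

(* If the u t are linearly independent modulo Q, and g lies in Q but not in the
   smaller prime P, then the g ^+ j * u t are independent modulo P: the term
   j = 0 is recovered modulo Q, and the rest is divided by g. *)
Lemma indep_powers (P Q : set (mpoly s k)) g (T : finType) (u : T -> mpoly s k) :
  is_prime P -> is_ideal Q -> P `<=` Q -> Q g -> ~ P g ->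
  (forall c : T -> k, Q (\sum_t c t *: u t) -> forall t, c t = 0) ->
  forall N (c : nat -> T -> k), P (\sum_(j < N) g ^+ j * \sum_t c j t *: u t) ->
  forall j t, (j < N)%N -> c j t = 0.
Proof.
move=> [_ _ Pprime] [_ Qadd Qmul] PQ Qg nPg indep; elim=> [//|N IHN] c.
rewrite big_ord_recl expr0 mul1r.
have -> : \sum_(i < N) g ^+ bump 0 i * \sum_t c (bump 0 i) t *: u t =
    (\sum_(i < N) g ^+ i * \sum_t c i.+1 t *: u t) * g.
  by rewrite mulr_suml; apply: eq_bigr => i _; rewrite /bump add1n exprSr mulrAC.
set w := \sum_(i < N) _ => Pc.
have c0 : forall t, c 0%N t = 0.
  apply: indep; rewrite -[X in Q X](addrK (w * g)); apply: Qadd; first exact: PQ.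
  by rewrite -mulNr; exact: Qmul.
move: Pc; rewrite big1 ?add0r => [|t _]; last by rewrite c0 scale0r.
by case/Pprime => // Pw [|j] t // ltjN; exact: (IHN (fun i => c i.+1)).
Qed.

(** Induction on the length, starting at the top prime, modulo which 1 is independent. Each step
    down multiplies the family by the powers g^j, j < N, of some [g] in [C 1] outside [C 0]. The
    degree constant [K] is chosen before [N], so degrees grow linearly in [N]. *)
Lemma chain_indep (C : nat -> set (mpoly s k)) (l : nat) :
  (forall i, (i <= l)%N -> is_prime (C i)) ->
  (forall i, (i < l)%N -> C i `<` C i.+1) ->
  exists K, forall N, exists (T : finType) (u : T -> mpoly s k),
  [/\ #|T| = (N ^ l)%N, forall t, degree_le (N * K) (u t) &
      forall c : T -> k, C 0%N (\sum_t c t *: u t) -> forall t, c t = 0].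
Proof.
elim: l C => [|l IHl] C Cprime Clt.
  exists 0%N => N'; exists unit, (fun=> 1).
  split=> [|t m|c]; first by rewrite card_unit.
    by rewrite muln0 mcoeff1 lt0n mdeg_eq0 => /negPf ->.
  rewrite (bigD1 tt) //= big1 => [|[]//]; rewrite addr0 => Cc [].
  have [idC nC1 _] := Cprime 0%N isT; apply: contra_notP nC1 => /eqP c0.
  have [_ Clin] := ideal_subspace idC; have [C0 _ _] := idC.
  have := Clin (c tt)^-1 _ _ Cc C0.
  by rewrite scalerA mulVf // scale1r addr0.
have [K HK] := IHl (fun i => C i.+1) (fun i => Cprime i.+1) (fun i => Clt i.+1).
have [C01 nC10] := Clt 0%N isT.
have /existsNP[g /not_implyP[C1g nC0g]] := nC10.
exists (mmeasure mdeg g + K)%N => N'; have [T [u [cardT degu indep]]] := HK N'.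
exists ('I_N' * T : finType)%type, (fun x : 'I_N' * T => g ^+ x.1 * u x.2); split.
- by rewrite card_prod card_ord cardT expnS.
- move=> [j t] /=; rewrite mulnDr; apply: degree_le_mul => //.
  have jN : (j * mmeasure mdeg g <= N' * mmeasure mdeg g)%N by rewrite leq_mul2r ltnW ?orbT.
  exact: (@degree_le_trans _ _ _ jN (@degree_le_exp _ _ j (@degree_le_msize g))).
move=> c Cc [j t].
have [idC1 _ _] := Cprime 1%N isT.
pose c' (i : nat) t := if insub i is Some i' then c (i', t) else 0.
have c'E (i : 'I_N') t' : c' i t' = c (i, t').
  by rewrite /c' insubT //= => lt_i; congr (c (_, _)); exact: val_inj.
rewrite -c'E; apply: (indep_powers (Cprime 0%N isT) idC1 C01 C1g nC0g indep (N := N')) => //.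
rewrite (_ : \sum_(_ < _) _ = \sum_x c x *: (g ^+ x.1 * u x.2)) //.
transitivity (\sum_(i < N') \sum_t' c (i, t') *: (g ^+ i * u t')).
  apply: eq_bigr => i _; rewrite mulr_sumr; apply: eq_bigr => t' _.
  by rewrite c'E scalerAr.
by rewrite pair_bigA; apply: eq_bigr => -[].
Qed.

(* The N ^ l independent polynomials given by chain_indep have degree O(N), hence
   live in a space of dimension O(N ^ s). *)
Lemma chain_length_le (S : set (set (mpoly s k))) l :
  (forall P, S P -> is_prime P) -> has_chain S l -> (l <= s)%N.
Proof.
move=> Sprime [C [CS Clt]]; rewrite leqNgt; apply/negP => lt_sl.
have [K HK] := chain_indep (fun i il => Sprime _ (CS i il)) Clt.
(* This choice makes N > (K+1)^s, hence (NK+1)^s <= N^s (K+1)^s < N^(s+1) <= N^l, so there are too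
   many independent polynomials for a box of side NK+1. *)
pose N := (K.+1 ^ s).+1; have [T [u [cardT degu indep]]] := HK N.
have [idC _ _] := Sprime _ (CS 0%N (leq0n l)).
have : (#|T| <= \prod_(i < s) (N * K).+1)%N.
  apply: (codim_indep (u := u) (codim_box (fun=> (N * K).+1))) => c bc.
  apply: indep; rewrite (_ : \sum_t _ = 0); first by case: idC.
  apply/mpolyP => m; rewrite mcoeff0.
  have [/bc //|] := boolP (box (fun=> (N * K).+1) m).
  rewrite negb_forall => /existsP[i]; rewrite -leqNgt => lt_m.
  rewrite raddf_sum big1 //= => t _; rewrite mcoeffZ (degu t) ?mulr0 //.
  by apply: leq_trans lt_m _; rewrite mdegE (bigD1 i) //= leq_addr.
rewrite cardT prod_nat_const card_ord leqNgt => /negP; apply.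
apply: (@leq_trans (N ^ s.+1)); last by rewrite leq_exp2l // ltnS expn_gt0.
apply: (@leq_ltn_trans ((N * K.+1) ^ s)).
  by case: (s) => // s'; rewrite leq_exp2r // mulnS -add1n leq_add2r.
by rewrite expnMn expnSr ltn_pmul2l ?expn_gt0 // ltnS.
Qed.

Lemma local_dim_maximal_at_0 : local_dim maximal_at_0 = s.
Proof.
apply: xget_unique => [|d [cd dmax]].
  split; first exact: has_chain_maximal_at_0.
  by move=> l; apply: chain_length_le => P [].
apply/eqP; rewrite eqn_leq; apply/andP; split.
  by apply: chain_length_le cd => P [].
exact/dmax/has_chain_maximal_at_0.
Qed.

End Dimension.

(** * Limits *)

Section CeilNat.
Context {R : realType}.
Implicit Types (x y : R) (m : nat).

Lemma ceil_nat_le x m : (ceil_nat x <= m)%N = (x <= m%:R).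
Proof.
have := ceil_le_int x (Posz m); rewrite /ceil_nat pmulrn => <-.
by case: (Num.ceil x) => n; rewrite ?lez_nat.
Qed.

Lemma ceil_nat_ge x : x <= (ceil_nat x)%:R.
Proof. by rewrite -ceil_nat_le. Qed.

Lemma ceil_nat_homo x y : x <= y -> (ceil_nat x <= ceil_nat y)%N.
Proof. by move=> xy; rewrite ceil_nat_le (le_trans xy) ?ceil_nat_ge. Qed.

Lemma ceil_nat_le_add1 x y : 0 <= y -> x <= y -> (ceil_nat x)%:R <= y + 1.
Proof.
move=> y0 xy; case E : (ceil_nat x) => [|m]; first by rewrite addr_ge0.
rewrite -natr1 lerD2r leNgt; apply/negP => ym.
have : (ceil_nat x <= m)%N by rewrite ceil_nat_le (le_trans xy) ?ltW.
by rewrite E ltnn.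
Qed.

Lemma ceil_nat_muln m x : (ceil_nat (m%:R * x) <= m * ceil_nat x)%N.
Proof. by rewrite ceil_nat_le natrM ler_wpM2l ?ceil_nat_ge. Qed.

End CeilNat.

Section Limits.
Import numFieldNormedType.Exports.
Context {R : realType}.

Lemma h_converges_h (A : comNzRingType) p s (I : set A) (f : s.-tuple A)
    (t : s.-tuple R) (u : nat -> R) (l : R) :
  h_seq p I f t = EFin \o u -> u @ \oo --> l ->
  h_converges p I f t /\ h p I f t = l.
Proof.
move=> hu ul; have hl : h_seq p I f t @ \oo --> l%:E.
  by rewrite hu; apply: cvg_comp ul _; exact: cvg_refl.
have -> : h p I f t = l by rewrite /h (cvg_lim _ hl).
by rewrite /h_converges (_ : h p I f t = l) //  /h (cvg_lim _ hl).
Qed.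

Variable p : nat.
Hypothesis p_gt1 : (1 < p)%N.

Let q e : R := (p ^ e)%:R.

Let q_gt0 e : 0 < q e.
Proof. by rewrite ltr0n expn_gt0 ltnW. Qed.

Lemma cvg_inv_pow : (q e)^-1 @[e --> \oo] --> (0 : R).
Proof.
have -> : (fun e => (q e)^-1) = GRing.exp (p%:R^-1 : R).
  by apply/funext => e; rewrite /q natrX exprVn.
by apply: cvg_expr; rewrite normfV normr_nat invf_lt1 ?ltr1n ?ltr0n // ltnW.
Qed.

Lemma cvg_ratio (x : nat -> nat) (l : R) :
  (forall e, q e * l - 1 <= (x e)%:R <= q e * l + 1) ->
  (x e)%:R / q e @[e --> \oo] --> l.
Proof.
move=> xl; apply: (squeeze_cvgr (f := fun e => l - (q e)^-1) (h := fun e => l + (q e)^-1)).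
- apply: nearW => e; have /andP[xl1 xl2] := xl e.
  rewrite ler_pdivlMr // ler_pdivrMr // mulrBl mulrDl mulVf ?gt_eqF // mulrC.
  by rewrite xl1 xl2.
- by rewrite -[X in _ --> X]subr0; apply: cvgB; [exact: cvg_cst | exact: cvg_inv_pow].
- by rewrite -[X in _ --> X]addr0; apply: cvgD; [exact: cvg_cst | exact: cvg_inv_pow].
Qed.

Lemma cvg_prod_ratio s (x : nat -> 'I_s -> nat) (l : 'I_s -> R) :
  (forall i e, q e * l i - 1 <= (x e i)%:R <= q e * l i + 1) ->
  (\prod_i x e i)%:R / q e ^+ s @[e --> \oo] --> \prod_i l i.
Proof.
move=> xl; rewrite (_ : (fun e => _) = fun e => \prod_i ((x e i)%:R / q e)).
  apply: cvg_big => [|i _]; first exact: mul_continuous.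
  exact: cvg_ratio.
apply/funext => e; rewrite natr_prod big_split /= prodr_const card_ord.
by rewrite exprVn.
Qed.

End Limits.

(** * Convergence of the normalized lengths *)

Section Kernel.
Context {R : realType} {k : fieldType} {s : nat}.
Variables (p : nat) (n : 'I_s -> nat) (r : R).
Hypothesis pk : p \in [pchar k].
Hypothesis n_gt0 : forall i, (0 < n i)%N.

Let p_gt1 : (1 < p)%N.
Proof. exact/prime_gt1/(pcharf_prime pk). Qed.

Let phi : mpoly s k := \sum_i mvar k i.
Let f : mpoly s k := \sum_i mvar k i ^+ n i.
Let q e : R := (p ^ e)%:R.
Let m e := ceil_nat (q e * r).

Let q_gt0 e : 0 < q e.
Proof. by rewrite ltr0n expn_gt0 ltnW. Qed.

Let kernel_exp e (i : 'I_s) := ceil_nat (q e * (n i)%:R^-1).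
Let coord_exp (a : 'I_s -> nat) e (i : 'I_s) :=
  ceil_nat ((q e - (a i)%:R) * (n i)%:R^-1).

Let kernel_seq e : R := (box_length (kernel_exp e) (phi ^+ m e))%:R / q e ^+ s.
Let coord_seq a e : R := (box_length (coord_exp a e) (phi ^+ m e))%:R / q e ^+ s.

Import numFieldNormedType.Exports.

(* Passing from e to e.+1 multiplies the exponents by at most p, and multiplying
   them by exactly p multiplies the length by p ^ s: the sequence decreases. *)
Lemma kernel_seq_cvg : cvgn kernel_seq.
Proof.
apply: nonincreasing_is_cvgn; last first.
  by exists 0 => _ [e _ <-]; rewrite divr_ge0 // exprn_ge0 // ltW.
apply/nonincreasing_seqP => e.
have qS : q e.+1 = p%:R * q e by rewrite /q expnS natrM.
rewrite /kernel_seq ler_pdivrMr ?exprn_gt0 // [in X in _ <= X]qS exprMn.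
rewrite mulrCA divfK ?expf_neq0 ?gt_eqF //.
rewrite -natrX -natrM ler_nat -box_length_frobenius //; apply: box_length_le => [i|].
- by rewrite /kernel_exp qS -mulrA ceil_nat_muln.
- by rewrite /m qS -mulrA ceil_nat_muln.
Qed.

Let kernel_exp_bounds i e :
  q e * (n i)%:R^-1 - 1 <= (kernel_exp e i)%:R <= q e * (n i)%:R^-1 + 1.
Proof.
have y0 : 0 <= q e * (n i)%:R^-1 by rewrite mulr_ge0 ?invr_ge0 // ltW.
rewrite ceil_nat_le_add1 // andbT; apply: le_trans (ceil_nat_ge _).
by rewrite gerBl.
Qed.

Let coord_exp_bounds a i e : (a i < n i)%N ->
  q e * (n i)%:R^-1 - 1 <= (coord_exp a e i)%:R <= q e * (n i)%:R^-1 + 1.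
Proof.
move=> lt_an; have y0 : 0 <= q e * (n i)%:R^-1 by rewrite mulr_ge0 ?invr_ge0 // ltW.
rewrite ceil_nat_le_add1 //; last by rewrite mulrBl gerBl mulr_ge0 ?invr_ge0.
rewrite andbT; apply: le_trans (ceil_nat_ge _).
by rewrite mulrBl lerD2l lerN2 ler_pdivrMr ?ltr0n // mul1r ler_nat ltnW.
Qed.

(** The sequence is squeezed between [kernel_seq - gap] and [kernel_seq]. The gap is the normalized
    difference of two box volumes, both of which tend to the product of the 1/n_i. *)
Lemma coord_seq_cvg a : (forall i, a i < n i)%N ->
  coord_seq a @ \oo --> limn kernel_seq.
Proof.
move=> lt_an.
have le_exp e i : (coord_exp a e i <= kernel_exp e i)%N.
  apply: ceil_nat_homo; rewrite ler_wpM2r ?invr_ge0 //.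
  by rewrite gerBl.
pose gap e : R := (\prod_i kernel_exp e i)%:R / q e ^+ s - (\prod_i coord_exp a e i)%:R / q e ^+ s.
apply: (squeeze_cvgr (f := fun e => kernel_seq e - gap e) (h := kernel_seq));
  last exact: kernel_seq_cvg.
- apply: nearW => e; rewrite /gap -!mulrBl !ler_pM2r ?invr_gt0 ?exprn_gt0 // ler_nat.
  rewrite box_length_le // andbT opprB addrA lerBlDr -!natrD ler_nat.
  exact: box_length_sub_le.
- rewrite -[X in _ --> X]subr0; apply: cvgB; first exact: kernel_seq_cvg.
  rewrite -(subrr (\prod_i (n i)%:R^-1)); apply: cvgB; apply: cvg_prod_ratio => //.
  by move=> i e; exact: coord_exp_bounds.
Qed.

Lemma diagonal_length_cvg :
  (box_length (fun=> p ^ e)%N (f ^+ m e))%:R / q e ^+ s @[e --> \oo] -->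
  (\prod_i (n i)%:R) * limn kernel_seq.
Proof.
rewrite (_ : (fun e => _) = fun e =>
  \sum_(a : {dffun forall i, 'I_(n i)}) coord_seq (fun i => a i) e); last first.
  apply/funext => e; rewrite -mulr_suml -natr_sum; congr (_%:R / _).
  apply: box_length_decomposition => // a i x.
  (* Both sides say q <= a_i + n_i x, the truncation at 0 agreeing with x being a natural number. *)
  rewrite ceil_nat_le ler_pdivrMr ?ltr0n // lerBlDl -natrM -natrD ler_nat.
  by rewrite mulnC.
have -> : (\prod_i (n i)%:R) * limn kernel_seq =
    \sum_(a : {dffun forall i, 'I_(n i)}) limn kernel_seq.
  by rewrite sumr_const -[RHS]mulr_natl card_dffun_ord natr_prod.
apply: cvg_big => [|a _]; first exact: add_continuous.
by apply: coord_seq_cvg => i.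
Qed.

End Kernel.

(** * Identification of the ideals *)

Section Ideals.
Context {R : realType} {k : fieldType} {s : nat}.
Implicit Types (c : 'I_s -> nat) (X : set (mpoly s k)) (psi : mpoly s k).

Lemma ideal_gen_box_with X c psi :
  (forall i, ideal_gen X (mvar k i ^+ c i)) -> ideal_gen X psi ->
  X `<=` box_ideal_with c psi -> ideal_gen X = box_ideal_with c psi.
Proof.
move=> Xc Xpsi sX; apply/seteqP; split.
  exact: smallest_sub (box_ideal_with_is_ideal c psi) sX.
exact: box_ideal_with_sub (ideal_genP X) Xc Xpsi.
Qed.

Lemma colength_box_with c psi :
  colength R (box_ideal_with c psi) = ((box_length c psi)%:R)%:E.
Proof.
apply: (@colength_codim k s R c); first exact: box_ideal_with_is_ideal.
  exact: box_ideal_with_box.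
exact: codim_box_ideal_with.
Qed.

Lemma maximal_at_0_ideal : is_ideal (maximal_at_0 : set (mpoly s k)).
Proof. by case: (kernel_prime (meval (fun=> 0) : {rmorphism mpoly s k -> k})). Qed.

Lemma maximal_at_0_sum (e : 'I_s -> nat) : (forall i, 0 < e i)%N ->
  maximal_at_0 (\sum_i mvar k i ^+ e i).
Proof.
move=> e_gt0; apply: ideal_sum => [|i _]; first exact: maximal_at_0_ideal.
by rewrite /maximal_at_0 /= rmorphXn /= mevalXU expr0n eqn0Ngt e_gt0.
Qed.

Lemma h_seq_box p l (I : set (mpoly s k)) (f : l.-tuple (mpoly s k)) (t : l.-tuple R)
    (c : nat -> 'I_s -> nat) (psi : nat -> mpoly s k) :
  (forall e, h_ideal I f t (p ^ e) = box_ideal_with (c e) (psi e)) ->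
  I `|` [set tnth f i | i in [set: 'I_l]] `<=` maximal_at_0 ->
  (forall i, ideal_gen (I `|` [set tnth f i | i in [set: 'I_l]]) (mvar k i)) ->
  h_seq p I f t = EFin \o fun e => (box_length (c e) (psi e))%:R / (p ^ e)%:R ^+ s.
Proof.
move=> hE sM varX; apply/funext => e.
rewrite /h_seq hE colength_box_with /h_dim radical_maximal_at_0 //.
by rewrite local_dim_maximal_at_0.
Qed.

(** In characteristic p the map x -> x^q is additive, so the elements whose q-th power lies in [J]
    form an ideal; it suffices to test it on the variables. *)
Lemma frobenius_power_vars_sub p e (J : set (mpoly s k)) : p \in [pchar k] ->
  is_ideal J -> (forall i, J (mvar k i ^+ (p ^ e))) ->
  frobenius_power (ideal_gen (range (mvar k))) (p ^ e) `<=` J.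
Proof.
move=> pk idJ Jvar; have [J0 Jadd Jmul] := idJ.
apply: smallest_sub => // _ [x Ix <-].
suff : ideal_gen (range (mvar k)) `<=` [set x | J (x ^+ (p ^ e))] by apply.
apply: smallest_sub => [|_ [i _ <-]]; last exact: Jvar.
split=> /= [|y z Jy Jz|a y Jy].
- by rewrite expr0n expn_eq0 eqn0Ngt (prime_gt0 (pcharf_prime pk)).
- rewrite exprDn_pchar; first exact: Jadd.
  by rewrite (eq_pnat _ (pchar_lalg (mpoly s k))) (eq_pnat _ (pcharf_eq pk)) pnatX
    pnat_id ?(pcharf_prime pk).
- by rewrite exprMn; exact: Jmul.
Qed.

Lemma h_ideal_vars p (f : mpoly s k) (r : R) e : p \in [pchar k] ->
  h_ideal (ideal_gen (range (mvar k))) [tuple f] [tuple r] (p ^ e) =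
  box_ideal_with (fun=> p ^ e)%N (f ^+ ceil_nat ((p ^ e)%:R * r)).
Proof.
move=> pk; apply: ideal_gen_box_with => [i||x [|[i _ <-]]].
- apply: sub_gen_smallest; left; apply: sub_gen_smallest.
  by exists (mvar k i) => //; apply: sub_gen_smallest; exists i.
- by apply: sub_gen_smallest; right; exists ord0.
- move: x; apply: frobenius_power_vars_sub => // [|i]; first exact: box_ideal_with_is_ideal.
  exact/box_ideal_with_box/box_ideal_power.
- by rewrite ord1; exact: box_ideal_with_gen.
Qed.

Lemma tnth_rcons_widen (T : Type) (t : s.-tuple T) x i :
  tnth [tuple of rcons t x] (widen_ord (leqnSn s) i) = tnth t i.
Proof. by rewrite !(tnth_nth x) /= nth_rcons size_tuple ltn_ord. Qed.

Lemma tnth_rcons_max (T : Type) (t : s.-tuple T) x :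
  tnth [tuple of rcons t x] ord_max = x.
Proof. by rewrite (tnth_nth x) /= nth_rcons size_tuple ltnn eqxx. Qed.

Lemma ord_widen_or_max (i : 'I_s.+1) :
  (exists j, i = widen_ord (leqnSn s) j) \/ i = ord_max.
Proof.
have [lt_is|le_si] := ltnP i s; [left; exists (Ordinal lt_is)|right]; apply: val_inj => //=.
by apply/eqP; rewrite eqn_leq le_si -ltnS ltn_ord.
Qed.

Lemma h_ideal_kernel q (phi : mpoly s k) (t : s.-tuple R) (r : R) : (0 < q)%N ->
  h_ideal [set 0] (kernel_gens phi) [tuple of rcons t r] q =
  box_ideal_with (fun i => ceil_nat (q%:R * tnth t i)) (phi ^+ ceil_nat (q%:R * r)).
Proof.
move=> q_gt0; apply: ideal_gen_box_with => [i||x [|[i _ <-]]].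
- apply: sub_gen_smallest; right; exists (widen_ord (leqnSn s) i) => //.
  by rewrite !tnth_rcons_widen tnth_mktuple.
- by apply: sub_gen_smallest; right; exists ord_max => //; rewrite !tnth_rcons_max.
- move: x; apply: smallest_sub; first exact: box_ideal_with_is_ideal.
  move=> _ [_ -> <-]; rewrite expr0n eqn0Ngt q_gt0.
  by case: (box_ideal_with_is_ideal (fun i => ceil_nat (q%:R * tnth t i))
    (phi ^+ ceil_nat (q%:R * r))).
- have [[j ->]| ->] := ord_widen_or_max i.
    rewrite !tnth_rcons_widen tnth_mktuple.
    apply: box_ideal_with_box.
    exact: (@box_ideal_power k s (fun i => ceil_nat (q%:R * tnth t i)) j).
  by rewrite !tnth_rcons_max; exact: box_ideal_with_gen.
Qed.

End Ideals.

(** * The formula for diagonal polynomials *)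

Unset Implicit Arguments.

Theorem theorem6p6 (R : realType) (k : fieldType) (p : nat)
    (hp : p \in [pchar k]) (s : nat) (n : 'I_s -> nat)
    (hn : forall i, (1 <= n i)%N) (r : R) :
  let phi : mpoly s k := \sum_(i < s) mvar k i in
  let f : mpoly s k := \sum_(i < s) mvar k i ^+ n i in
  let I : set (mpoly s k) := ideal_gen (range (mvar k)) in
  let t : s.-tuple R := [tuple ((n i)%:R)^-1 | i < s] in
  [/\ h_converges p I [tuple f] [tuple r],
      kernel_converges p phi t r &
      h p I [tuple f] [tuple r] =
        (\prod_(i < s) (n i)%:R) * kernel_fun p phi t r].
Proof.
move=> phi f I t; have p_gt1 := prime_gt1 (pcharf_prime hp).
have M_var i : maximal_at_0 (mvar k i) by rewrite /maximal_at_0 /= mevalXU.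
have M_phi : maximal_at_0 phi.
  by rewrite /phi; under eq_bigr do rewrite -[mvar _ _]expr1; exact: maximal_at_0_sum.
pose m e := ceil_nat ((p ^ e)%:R * r).
have q_gt0 e : (0 < p ^ e)%N by rewrite expn_gt0 ltnW.
(* In both sequences the generators have the maximal ideal at the origin as radical, whose local
   dimension is [s]; this gives the normalization by q^s. *)
have hE : h_seq p I [tuple f] [tuple r] =
    EFin \o fun e => (box_length (fun=> p ^ e)%N (f ^+ m e))%:R / (p ^ e)%:R ^+ s.
  apply: h_seq_box => [e|x [|[i _ <-]]|i].
  - exact: h_ideal_vars.
  - by move: x; apply: smallest_sub => [|_ [i _ <-]] //; exact: maximal_at_0_ideal.
  - by rewrite ord1; exact: maximal_at_0_sum.
  - by apply: sub_gen_smallest; left; apply: sub_gen_smallest; exists i.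
have kE : h_seq p [set 0] (kernel_gens phi) [tuple of rcons t r] =
    EFin \o fun e => (box_length (fun i => ceil_nat ((p ^ e)%:R * (n i)%:R^-1 : R))
      (phi ^+ m e))%:R / (p ^ e)%:R ^+ s.
  apply: (h_seq_box (c := fun e i => ceil_nat ((p ^ e)%:R * (n i)%:R^-1 : R))
    (psi := fun e => phi ^+ m e)) => [e|x [-> |[i _ <-]]|i].
  - rewrite h_ideal_kernel //; congr box_ideal_with.
    by apply/funext => i; rewrite tnth_mktuple.
  - by have [] := maximal_at_0_ideal (k := k) (s := s).
  - have [[j ->]| ->] := ord_widen_or_max i; last by rewrite tnth_rcons_max.
    by rewrite tnth_rcons_widen tnth_mktuple.
  - apply: sub_gen_smallest; right; exists (widen_ord (leqnSn s) i) => //.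
    by rewrite tnth_rcons_widen tnth_mktuple.
(* Both limits are expressed through the limit of the same kernel sequence, which yields the
   formula. *)
have [hcvg hlim] := h_converges_h hE (@diagonal_length_cvg R k s p n r hp hn).
have [kcvg klim] := h_converges_h kE (@kernel_seq_cvg R k s p n r hp).
by split=> //; rewrite hlim /kernel_fun klim.
Qed.
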